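(* Let $T$ be a set. The set $\Theta(T)$ of all functions $\theta:\mathcal{F}(T)\to[0,\infty)$ that are the ECF of some simple max-stable process on $T$ is compact with respect to the topology of pointwise convergence (the product topology on $\mathbb{R}^{\mathcal{F}(T)}$).
   Context: $\mathcal{F}(T)$ is the set of finite subsets of $T$. Simple max-stable process: a process $X=\{X_t\}_{t\in T}$ with $\mathbb{P}(X_t\le x)=e^{-1/x}$ for all $t\in T$, $x>0$, such that for every $n\in\mathbb{N}$ and independent copies $X^{(1)},\dots,X^{(n)}$ of $X$ the process $\{\bigvee_{i=1}^nX^{(i)}_t\}_{t\in T}$ has the same law (finite-dimensional distributions) as $\{nX_t\}_{t\in T}$. Extremal coefficient function (ECF) of a simple max-stable process $X$: $\theta:\mathcal{F}(T)\to[0,\infty)$ with $\theta(\varnothing)=0$ and $\theta(A)=-x\log\mathbb{P}(\bigvee_{t\in A}X_t\le x)$ for non-empty finite $A\subset T$ (independent of $x>0$). *)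

(* Defs.v *)
From HB Require Import structures.
From mathcomp Require Import all_boot all_order all_algebra finmap.
From mathcomp Require Import all_classical all_reals all_analysis.

Set Implicit Arguments.
Unset Strict Implicit.
Unset Printing Implicit Defensive.

Import Order.TTheory GRing.Theory Num.Theory.
Import numFieldNormedType.Exports.

Local Open Scope classical_set_scope.
Local Open Scope ring_scope.

Section Processes.
Context (R : realType) (T : choiceType).

Definition fdd d (Omega : measurableType d) (P : probability Omega R)
    (Y : T -> Omega -> R) (m : nat) (t : 'I_m -> T) :
    set (m.-tuple (measurableTypeR R)) -> \bar R :=
  pushforward P (fun w => [tuple Y (t i) w | i < m]).

Definition same_law
    d (Omega : measurableType d) (P : probability Omega R) (Y : T -> Omega -> R)
    d' (Omega' : measurableType d') (P' : probability Omega' R)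
    (Y' : T -> Omega' -> R) : Prop :=
  forall (m : nat) (t : 'I_m -> T) (B : set (m.-tuple (measurableTypeR R))),
    measurable B -> fdd P Y t B = fdd P' Y' t B.

Definition process_sigma_algebra d (Omega : measurableType d)
    (Y : T -> Omega -> R) : set_system Omega :=
  <<s \bigcup_t preimage_set_system setT (Y t)
        (@measurable _ (measurableTypeR R)) >>.

Definition independent_processes d (Omega : measurableType d)
    (P : probability Omega R) (n : nat) (Y : 'I_n -> T -> Omega -> R) : Prop :=
  forall (J : {set 'I_n}) (E : 'I_n -> set Omega),
    (forall i, i \in J -> process_sigma_algebra (Y i) (E i)) ->
    P (\bigcap_(i in [set` J]) E i) = (\prod_(i in J) P (E i))%E.

(* The copies may live on another probability space: the one carrying X need
   not be rich enough to support them. *)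
Definition independent_copies
    d (Omega : measurableType d) (P : probability Omega R)
    (X : T -> {RV P >-> R})
    d' (Omega' : measurableType d') (P' : probability Omega' R)
    (n : nat) (Y : 'I_n -> T -> {RV P' >-> R}) : Prop :=
  (forall i, same_law P' (fun t => Y i t) P (fun t => X t)) /\
  independent_processes P' (fun i t => Y i t).

Definition simple_max_stable d (Omega : measurableType d)
    (P : probability Omega R) (X : T -> {RV P >-> R}) : Prop :=
  (forall (t : T) (x : R), 0 < x -> cdf (X t) x = (expR (- (1 / x)))%:E) /\
  (forall (n : nat) d' (Omega' : measurableType d') (P' : probability Omega' R)
      (Y : 'I_n.+1 -> T -> {RV P' >-> R}),
    independent_copies X Y ->
    same_law P' (fun t w => \big[Num.max/Y ord0 t w]_(i < n.+1) Y i t w)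
             P (fun t w => n.+1%:R * X t w)).

Definition is_ECF d (Omega : measurableType d) (P : probability Omega R)
    (X : T -> {RV P >-> R}) (theta : {fset T} -> R) : Prop :=
  theta fset0 = 0 /\
  forall (A : {fset T}) (x : R), A != fset0 -> 0 < x ->
    theta A = - x * ln (fine
      (P [set w | (\big[maxe/-oo]_(t <- A) (X t w)%:E <= x%:E)%E])).

Definition Theta : set {ptws {fset T} -> R} :=
  [set theta | (forall A, 0 <= theta A) /\
    exists d (Omega : measurableType d) (P : probability Omega R)
      (X : T -> {RV P >-> R}), simple_max_stable X /\ is_ECF X theta].

End Processes.

(* Main.v *)
Require Import Defs.
From HB Require Import structures.
From mathcomp Require Import all_boot all_order all_algebra finmap.
From mathcomp Require Import all_classical all_reals all_analysis
  measurable_realfun.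
From mathcomp Require Import ring lra.
Set Implicit Arguments.
Unset Strict Implicit.
Unset Printing Implicit Defensive.
Import Order.TTheory GRing.Theory Num.Theory.
Import numFieldNormedType.Exports.
Local Open Scope classical_set_scope.
Local Open Scope ring_scope.

(** Put [Delta_a f K = f K - f (a |` K)] for [f : {fset T} -> R].  The extremal
    coefficient functions are exactly the [theta] with [theta fset0 = 0] and
    [theta [fset t] = 1] all of whose iterated differences of positive order are
    nonpositive (complete alternation).  These conditions are closed under
    pointwise limits and bound [theta A] by the number of elements of [A], so
    compactness follows from Tychonoff's theorem.

    Necessity: by inclusion-exclusion, [A |-> P (max_A X <= n) = exp (- theta A
      / n)]
    has nonnegative iterated differences, and [n (1 - exp (- theta A / n))] tends
    to [theta A].

    Sufficiency: for a finite set [S] of pairs [(t, y)] let [psi S] be the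
    integral over [u > 0] of [theta {t | (t, y) in S for some y >= u}].  It is
    completely alternating because [theta] is, hence [exp (- psi)] has
    nonnegative iterated differences, and these are the inclusion-exclusion
    weights of a finitely additive measure on the cube of all 0-1 functions of
    [(t, y)].  Cylinders being clopen in a compact space, that measure extends to
    a probability with [P (E (t, y) for all (t, y) in S) = exp (- psi S)].  The
    process [X t = inf {1 / y | E (t, y)}] is then max-stable since [psi] is
    homogeneous in the levels [y]. *)

(** * Iterated differences and complete monotonicity *)

Section Differences.
Context (R : realType) (I : choiceType).
Implicit Types (f g : {fset I} -> R) (s : seq I) (K : {fset I}) (a : I).

Fixpoint nabla f s K : R :=
  if s is a :: s' then nabla f s' K - nabla f s' (a |` K)%fset else f K.

(** Bounding the order permits induction on it: taking one difference of a product or an exponential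
    lowers the order by one. *)
Definition cm_upto n f := forall s K, (size s <= n)%N -> 0 <= nabla f s K.
Definition completely_monotone f := forall s K, 0 <= nabla f s K.
Definition completely_alternating f := forall a s K, nabla f (a :: s) K <= 0.

Lemma eq_nabla f g s K : f =1 g -> nabla f s K = nabla g s K.
Proof. by move=> fg; elim: s K => [|a s IH] K /=; rewrite ?fg// !IH. Qed.

Lemma nablaD f g s K :
  nabla (fun L => f L + g L) s K = nabla f s K + nabla g s K.
Proof. by elim: s K => //= a s IH K; rewrite !IH; ring. Qed.

Lemma nablaZ c f s K : nabla (fun L => c * f L) s K = c * nabla f s K.
Proof. by elim: s K => //= a s IH K; rewrite !IH; ring. Qed.

Lemma nablaB f g s K :
  nabla (fun L => f L - g L) s K = nabla f s K - nabla g s K.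
Proof. by elim: s K => //= a s IH K; rewrite !IH; ring. Qed.

Lemma nabla_cst c a s K : nabla (fun=> c) (a :: s) K = 0.
Proof.
elim: s a K => [|b s IH] a K; first by rewrite /= subrr.
by move: (IH b K) (IH b (a |` K)%fset) => /= -> ->; rewrite subrr.
Qed.

Lemma nabla_shift f a s K :
  nabla (fun L => f (a |` L)%fset) s K = nabla f s (a |` K)%fset.
Proof. by elim: s K => //= b s IH K; rewrite !IH fsetUCA. Qed.

(** Differences commute with shifts, so the outermost difference can be moved onto the function
    itself; the inductions on the order use this form. *)
Lemma nabla_cons f a s K :
  nabla f (a :: s) K = nabla (fun L => f L - f (a |` L)%fset) s K.
Proof. by rewrite nablaB nabla_shift. Qed.

Lemma nabla_eq0 f a s K : a \in s -> a \in K -> nabla f s K = 0.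
Proof.
elim: s K => //= b s IH K; rewrite inE => /orP[/eqP<- aK|sa aK].
  by rewrite (_ : (a |` K)%fset = K) ?subrr//; apply/fsetUidPr; rewrite fsub1set.
by rewrite !IH ?subrr// in_fset1U aK orbT.
Qed.

Lemma cvg_nabla (U : Type) (F : set_system U) {FF : Filter F}
    (g : U -> {fset I} -> R) f s K :
  (forall L, g u L @[u --> F] --> f L) ->
  nabla (g u) s K @[u --> F] --> nabla f s K.
Proof. by move=> Ff; elim: s K => //= a s IH K; exact: cvgB. Qed.

Lemma cm_uptoW m n f : (m <= n)%N -> cm_upto n f -> cm_upto m f.
Proof. by move=> mn cf s K sm; apply: cf; exact: leq_trans mn. Qed.

Lemma cm_upto_diff n f a : cm_upto n.+1 f ->
  cm_upto n (fun L => f L - f (a |` L)%fset).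
Proof. by move=> cf s K sn; rewrite -nabla_cons; apply: cf. Qed.

Lemma cm_upto_shift n f a : cm_upto n f -> cm_upto n (fun L => f (a |` L)%fset).
Proof. by move=> cf s K sn; rewrite nabla_shift; apply: cf. Qed.

Lemma cm_uptoD n f g : cm_upto n f -> cm_upto n g ->
  cm_upto n (fun L => f L + g L).
Proof. by move=> cf cg s K sn; rewrite nablaD addr_ge0 ?cf ?cg. Qed.

(* Leibniz: the difference of a product is [D f * g + (shift f) * D g]. *)
Lemma cm_uptoM n f g : cm_upto n f -> cm_upto n g ->
  cm_upto n (fun L => f L * g L).
Proof.
elim: n f g => [|n IH] f g cf cg s K.
  by case: s => //= _; rewrite mulr_ge0 // ?(cf [::]) ?(cg [::]).
case: s => [_|a s sn]; first by rewrite mulr_ge0 // ?(cf [::]) ?(cg [::]).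
rewrite nabla_cons (@eq_nabla _ (fun L => (f L - f (a |` L)%fset) * g L +
  f (a |` L)%fset * (g L - g (a |` L)%fset))); last by move=> L; ring.
apply: (cm_uptoD (n := n)) => //; first apply: IH; last apply: IH.
- exact: cm_upto_diff.
- exact: cm_uptoW cg.
- by apply: cm_upto_shift; exact: cm_uptoW cf.
- exact: cm_upto_diff.
Qed.

(** Powers of [g] are covered by the product rule, hence so are the partial sums of the exponential
    series without constant term; the sign passes to the limit. *)
Lemma cm_upto_exp_sub1 n g : cm_upto n g -> cm_upto n (fun L => expR (g L) - 1).
Proof.
move=> cg s K sn.
(* The index [k.+1] makes the constant term present from the start, so subtracting 1 leaves
   [u 0 = 0]. *)
pose u k L := series (exp_coeff (g L)) k.+1 - 1.
have u_cvg L : u k L @[k --> \oo] --> expR (g L) - 1.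
  apply: cvgB; last exact: cvg_cst.
  rewrite (cvg_shiftS (series (exp_coeff (g L)))).
  exact: is_cvg_series_exp_coeff.
have uS k L : u k.+1 L = u k L + (k.+1)`!%:R^-1 * g L ^+ k.+1.
  rewrite /u !seriesEnat/= big_nat_recr//= exp_coeffE; ring.
have cX k : cm_upto n (fun L => g L ^+ k.+1).
  elim: k => [|k IH] t L tn.
    by rewrite (@eq_nabla _ g) ?cg// => M; rewrite expr1.
  under eq_nabla do rewrite exprS.
  by apply: (cm_uptoM cg IH).
have cu k : cm_upto n (u k).
  elim: k => [|k IH] t L tn.
    have u0 : u 0%N =1 (fun=> 0).
      by move=> M; rewrite /u seriesEnat/= big_nat1 exp_coeffE/= expr0 fact0
        invr1 mulr1 subrr.
    rewrite (eq_nabla _ _ u0); case: t {tn} => [|a t]; first by [].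
    by rewrite nabla_cst.
  rewrite (eq_nabla _ _ (uS k)) nablaD addr_ge0 ?IH// nablaZ mulr_ge0 ?cX//.
have nu : nabla (u k) s K @[k --> \oo] --> nabla (fun L => expR (g L) - 1) s K.
  exact: cvg_nabla.
rewrite -(cvg_lim _ nu)//; apply: limr_ge; first by apply/cvg_ex; eexists;
  exact: nu.
by apply: nearW => k; exact: cu.
Qed.

(** With [fa] the shift of [f] by [a], the difference of [expR (- f)] along [a] is
    [expR (- fa) * (expR (fa - f) - 1)]. The first factor falls under the induction hypothesis; in
    the second, [fa - f] is completely monotone because [f] alternates. *)
Lemma completely_monotone_expN f :
  completely_alternating f -> completely_monotone (fun L => expR (- f L)).
Proof.
move=> caf s K; suff H n : cm_upto n (fun L => expR (- f L)) by exact: (H (size s)).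
elim: n f caf {s K} => [|n IH] f caf s K.
  by case: s => // _; rewrite /= expR_ge0.
case: s => [_|a s sn]; first by rewrite /= expR_ge0.
pose fa L := f (a |` L)%fset.
rewrite nabla_cons (@eq_nabla _ (fun L => expR (- fa L) *
  (expR (fa L - f L) - 1))); last first.
  by move=> L; rewrite mulrBr -expRD mulr1 addrA addNr add0r.
apply: (cm_uptoM (n := n)) => //.
- by apply: (IH fa) => b t L; rewrite nabla_shift caf.
- apply: cm_upto_exp_sub1 => t L _.
  by rewrite -oppr_le0 -mulN1r -nablaZ (@eq_nabla _ (fun M => f M - f (a |`
    M)%fset))
    -?nabla_cons ?caf// => M; rewrite mulN1r opprB.
Qed.

End Differences.

(** * A finitely additive measure on the cube *)

Section CubeContent.
Context (R : realType) (I : choiceType) (Phi : {fset I} -> R).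
Hypothesis cmPhi : completely_monotone Phi.
Hypothesis Phi0 : Phi fset0 = 1.
Implicit Types (A B : set (I -> bool)) (s Z : seq I) (K N S : {fset I}).

(* Decides the coordinates in [s] one at a time; the vertex with ones on [K]
   and zeros on [Z] gets the inclusion-exclusion weight [nabla Phi Z K]. *)
Fixpoint cube_weight s K Z A : R :=
  if s is a :: s' then cube_weight s' (a |` K)%fset Z A + cube_weight s' K (a
    :: Z) A
  else nabla Phi Z K * `[< A (fun i => i \in K) >]%:R.

Lemma cube_weight_ge0 s K Z A : 0 <= cube_weight s K Z A.
Proof.
elim: s K Z => [|a s IH] K Z /=; last by rewrite addr_ge0.
by rewrite mulr_ge0// ler0n.
Qed.

Lemma cube_weightU s K Z A B : A `&` B = set0 ->
  cube_weight s K Z (A `|` B) = cube_weight s K Z A + cube_weight s K Z B.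
Proof.
move=> AB; elim: s K Z => [|a s IH] K Z /=; last by rewrite !IH; ring.
rewrite -mulrDr; congr (_ * _); set w := fun i => i \in K.
have nAB : ~ (A w /\ B w) by rewrite -[_ /\ _]/((A `&` B) w) AB.
have [Aw|nA] := asboolP (A w); have [Bw|nB] := asboolP (B w).
- by case: nAB.
- by rewrite asboolT ?addr0//; left.
- by rewrite asboolT ?add0r//; right.
- by rewrite asboolF ?addr0// => -[].
Qed.

(** Deciding a coordinate splits the weight into two differences whose sum telescopes. At a leaf
    violating the constraint, some coordinate of [N] lies in [Z], and the difference along it
    vanishes. *)
Lemma cube_weight_orthant s K Z N :
  (forall i, i \in N -> [|| i \in K, i \in Z | i \in s]) ->
  cube_weight s K Z [set w | forall i, i \in N -> w i] = nabla Phi Z (K `|` N)%fset.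
Proof.
elim: s K Z => [|a s IH] K Z NKZ /=.
  case: asboolP => [/= NK|NK].
    rewrite mulr1 (_ : K `|` N = K)%fset//; apply/fsetUidPl/fsubsetP => i.
    exact: NK.
  rewrite mulr0; apply/esym.
  suff [i iZ iN] : exists2 i, i \in Z & i \in N.
    by rewrite (nabla_eq0 _ iZ)// inE iN orbT.
  apply: contrapT => H; apply: NK => i iN.
  have := NKZ i iN; rewrite in_nil orbF => /orP[//|iZ].
  by exfalso; apply: H; exists i.
rewrite !IH; first by rewrite /= fsetUA subrKC.
- by move=> i /NKZ; rewrite !inE; do !case: (_ == _); do ! case: (_ \in _).
- by move=> i /NKZ; rewrite !inE; do !case: (_ == _); do ! case: (_ \in _).
Qed.

Lemma fmap_ultra (T U : Type) (f : T -> U) (F : set_system T) :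
  UltraFilter F -> UltraFilter (f @ F).
Proof.
move=> FU; split; first exact: fmap_proper_filter.
move=> G GP sFG; rewrite predeqE => A; split; last exact: sFG.
move=> GA; have [//|FnA] := in_ultra_setVsetC (f @^-1` A) FU.
have /sFG GnA : (f @ F) (~` A) by [].
by case: (@filter_not_empty _ G GP); rewrite -(setICr A); exact: filterI.
Qed.

(** Each finite [S] gives a discrete measure with the right weights on the coordinates in [S]. An
    ultrafilter limit over growing [S] exists for every subset of the cube at once and preserves
    sign and additivity. *)
Lemma cube_content_exists : exists m : set (I -> bool) -> R,
  [/\ forall A, 0 <= m A,
      forall A B, A `&` B = set0 -> m (A `|` B) = m A + m B,
      m setT = 1 &
      forall N, m [set w | forall i, i \in N -> w i] = Phi N].
Proof.
pose F : set_system {fset I} := filter_from setT (fun N => [set S | N `<=` S]%fset).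
have FF : ProperFilter F.
  apply: filter_from_proper; last by move=> N _; exists N => /=;
    rewrite fsubset_refl.
  apply: filter_fromT_filter; first by exists fset0.
  move=> M N; exists (M `|` N)%fset => S /=; rewrite fsubUset => /andP[].
  by move=> MS NS; split.
have [U [UU sU]] := ultraFilterLemma FF.
pose p S A := cube_weight S fset0 [::] A.
have pT S : p S setT = 1.
  rewrite (_ : setT = [set w : I -> bool |
      forall i, i \in (fset0 : {fset I}) -> w i]).
    by rewrite /p cube_weight_orthant ?fset0U//= => i; rewrite inE.
  by apply/seteqP; split => // w _ i; rewrite inE.
have p01 S A : p S A \in `[0, 1].
  rewrite in_itv /= cube_weight_ge0 -(pT S) -(setUv A) /p cube_weightU ?setICr//.
  by rewrite lerDl cube_weight_ge0.
(* The values stay in the compact interval from 0 to 1, where every ultrafilter converges. *)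
have pcvg A : exists l : R, p S A @[S --> U] --> l.
  have := @segment_compact R 0 1; rewrite compact_ultra.
  have : (p ^~ A @ U) [set` `[0, 1]] by apply: nearW => S; exact: p01.
  by move=> + /(_ _ (fmap_ultra (p ^~ A) UU)) => /[swap] /[apply] -[l [_ ?]];
    exists l.
pose m A := lim (p S A @[S --> U]).
have mP A : p S A @[S --> U] --> m A.
  by have [l pl] := pcvg A; rewrite /m (cvg_lim _ pl).
exists m; split.
- move=> A; apply: limr_ge; first by apply/cvg_ex; exists (m A); exact: mP.
  by apply: nearW => S; exact: cube_weight_ge0.
- move=> A B AB; apply: cvg_lim => //.
  under eq_cvg do rewrite /p cube_weightU//.
  exact: cvgD (mP A) (mP B).
- by apply: cvg_lim => //; under eq_cvg do rewrite pT; exact: cvg_cst.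
- move=> N; apply: cvg_lim => //; apply: cvg_near_cst.
  (* As soon as [S] contains [N], the value is exactly [Phi N]. *)
  apply: sU; exists N => // S /= NS; rewrite /p cube_weight_orthant ?fset0U// => i.
  by move=> /(fsubsetP NS) ->; rewrite orbT.
Qed.

End CubeContent.

(** * Cylinders: their algebra and their topology *)

Definition cube (I : choiceType) : Type := I -> bool.

HB.instance Definition _ (I : choiceType) := Pointed.copy (cube I) (I -> bool).

HB.instance Definition _ (I : choiceType) := Pointed.on {ptws I -> bool}.

Section Cylinders.
Context (I : choiceType).
Implicit Types (A B : set (cube I)) (N : {fset I}).

(** The algebra of cylinders is attached to the alias [cube I] and the product topology to
    [{ptws I -> bool}]; the points are the same. *)
Definition cylinder A := exists N, forall w w' : cube I,
  (forall i, i \in N -> w i = w' i) -> A w -> A w'.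

Lemma cylinder0 : cylinder set0. Proof. by exists fset0. Qed.

Lemma cylinderU : setU_closed cylinder.
Proof.
move=> A B [M MA] [N NB]; exists (M `|` N)%fset => w w' ww' [Aw|Bw].
- by left; apply: MA Aw => i iM; rewrite ww'// inE iM.
- by right; apply: NB Bw => i iN; rewrite ww'// inE iN orbT.
Qed.

Lemma cylinderC : setC_closed cylinder.
Proof.
move=> A [M MA]; exists M => w w' ww' nAw Aw'; apply: nAw.
by apply: MA Aw' => i /ww'.
Qed.

HB.instance Definition _ := @isAlgebraOfSets.Build default_measure_display
  (cube I) cylinder cylinder0 cylinderU cylinderC.

(** Since [bool] is discrete, each of the finitely many relevant coordinates is locally constant. *)
Lemma cylinder_open A : cylinder A -> open (A : set {ptws I -> bool}).
Proof.
move=> [N NA]; rewrite openE => w Aw.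
have : \forall w' \near (w : {ptws I -> bool}), forall i, i \in N -> w' i = w i.
  have := @filter_bigI _ I N (fun i =>
    [set w' : {ptws I -> bool} | w' i = w i]) (nbhs (w : {ptws I -> bool})) _.
  apply => i iN; have := @proj_continuous I (fun=> bool) i w [set w i].
  by apply; exact: discrete_set1.
by apply: filterS => w' ww'; apply: NA Aw => i /ww'.
Qed.

Lemma cube_compact : compact [set: {ptws I -> bool}].
Proof.
have := @tychonoff I (fun=> bool) (fun=> setT) (fun=> bool_compact).
by congr (compact _); apply/seteqP; split.
Qed.

End Cylinders.

(** * Extension of the content to a probability measure *)

Section CubeMeasure.
Context (R : realType) (I : choiceType) (m : set (I -> bool) -> R).
Hypothesis m_ge0 : forall A, 0 <= m A.
Hypothesis mU : forall A B, A `&` B = set0 -> m (A `|` B) = m A + m B.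

Definition cube_content (A : set (cube I)) : \bar R := (m A)%:E.

Lemma cube_content_ge0 A : (0 <= cube_content A)%E.
Proof. by rewrite lee_fin. Qed.

Lemma cube_content_semi_additive : measure_function.semi_additive cube_content.
Proof.
move=> F n mF tF _.
have m0 : m set0 = 0.
  have := @mU set0 set0 (setI0 _); rewrite setU0 => /eqP.
  by rewrite -subr_eq subrr eq_sym => /eqP.
elim: n => [|n IH]; first by rewrite !big_ord0 /cube_content m0.
rewrite !big_ord_recr/= -IH.
rewrite /cube_content -EFinD -mU//.
rewrite -(bigcup_mkord n F); apply/seteqP; split => // w [[k /= kn Fk] Fn].
by move: kn; rewrite (tF k n)// ?ltnn//; exists w.
Qed.

HB.instance Definition _ := isContent.Build _ _ _ cube_content
  cube_content_ge0 cube_content_semi_additive.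

(** A cylinder is closed in a compact space, so a countable cover by open cylinders has a finite
    subcover and finite subadditivity suffices. *)
Lemma cube_content_sigma_subadditive : measurable_subset_sigma_subadditive
  cube_content.
Proof.
move=> A F mF mA AF.
have cA : compact (A : set {ptws I -> bool}).
  apply: subclosed_compact (@cube_compact I) _ => //.
  by rewrite -(setCK A); apply: open_closedC; apply: cylinder_open;
    exact: cylinderC.
move: cA; rewrite (@compact_cover {ptws I -> bool}) => /(_ nat setT F).
case=> [n _|w /AF[n _ Fw]|D _ AD]; [exact/cylinder_open/mF|by exists n|].
(* One more than the largest index of the subcover, so that the first [N] sets contain it. *)
pose N := (\max_(i <- D) i).+1.
apply: (@le_trans _ _ (\sum_(k < N) cube_content (F k))%E).
  apply: content_subadditive => //; rewrite -bigcup_mkord.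
  apply: subset_trans AD _ => w [k /= kD Fk]; exists k => //=.
  by rewrite ltnS (big_rem k)//= leq_maxl.
rewrite -(big_mkord xpredT (fun k => cube_content (F k))).
by apply: nneseries_lim_ge => k _ _; exact: cube_content_ge0.
Qed.

HB.instance Definition _ := Content_SigmaSubAdditive_isMeasure.Build _ _ _
  cube_content
  cube_content_sigma_subadditive.

(* The unused argument lets unification find the proof needed by the probability
   instance. *)
Definition cube_probability (_ : m setT = 1) := measure_extension cube_content.

Section Probability.
Hypothesis mT : m setT = 1.

HB.instance Definition _ := Measure.on (cube_probability mT).

Lemma cube_probabilityE A : cylinder A -> cube_probability mT A = (m A)%:E.
Proof.
by move=> cA; rewrite /cube_probability /measure_extension measurable_mu_extE.
Qed.

Lemma cube_probability_setT : cube_probability mT setT = 1%E.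
Proof. by rewrite cube_probabilityE ?mT//; exists fset0. Qed.

HB.instance Definition _ := Measure_isProbability.Build _ _ _
  (cube_probability mT) cube_probability_setT.

End Probability.

End CubeMeasure.

(** The cube is the sample space, and [E i] is the event that coordinate [i] equals one. *)
Lemma completely_monotone_probability (R : realType) (I : choiceType)
    (Phi : {fset I} -> R) :
  completely_monotone Phi -> Phi fset0 = 1 ->
  exists d (Omega : measurableType d) (P : probability Omega R) (E : I -> set
    Omega),
    (forall i, measurable (E i)) /\
    (forall N : {fset I}, P (\bigcap_(i in [set` N]) E i) = (Phi N)%:E).
Proof.
move=> cmPhi Phi0; have [m [m0 mU mT mE]] := cube_content_exists cmPhi Phi0.
exists _, _, (cube_probability m0 mU mT), (fun i => [set w : cube I | w i]).
split=> [i|N].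
  apply: sub_sigma_algebra; exists [fset i]%fset => w w' ww' /=.
  by rewrite ww' ?inE.
rewrite (_ : \bigcap_(i in _) _ = [set w : cube I | forall i, i \in N -> w i])//.
apply: etrans (cube_probabilityE m0 mU mT _) _; last by rewrite mE.
by exists N => w w' ww' Nw i iN; rewrite -ww' ?Nw.
Qed.

(** * Step functions on the positive half-line and their integrals *)

Section StepFunctions.
Context (R : realType).
Implicit Types (L : seq (R * R)) (u c : R).

Definition step L u : R := \sum_(p <- L) p.1 * (u <= p.2)%R%:R.
(** For positive levels this is the integral of [step L] over the positive half-line. *)
Definition step_int L : R := \sum_(p <- L) p.1 * p.2.

Lemma seq_min (X : eqType) (f : X -> R) (s : seq X) : s != [::] ->
  exists2 x, x \in s & forall y, y \in s -> f x <= f y.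
Proof.
elim: s => [//|a [|b s] IH] _.
  by exists a => [|y]; rewrite ?mem_head// inE => /eqP->.
have [//|x xs xmin] := IH.
have [fax|fxa] := leP (f a) (f x).
  exists a; rewrite ?mem_head// => y; rewrite inE => /orP[/eqP->//|/xmin].
  exact: le_trans.
exists x => [|y]; first by rewrite inE xs orbT.
by rewrite inE => /orP[/eqP->|/xmin//]; exact: ltW.
Qed.

(* Cutting off the slab below the lowest level leaves a shifted step function
   with fewer terms. *)
Lemma step_int_ge0 L : {in L, forall p, 0 < p.2} ->
  (forall u, 0 < u -> 0 <= step L u) -> 0 <= step_int L.
Proof.
have [n] := ubnP (size L); elim: n L => // n IH L sL Lpos L0.
have [->|Ln0] := eqVneq L [::]; first by rewrite /step_int big_nil.
have [p pL pmin] := seq_min snd Ln0.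
have p0 := Lpos p pL.
pose L' := [seq (q.1, q.2 - p.2) | q <- L & p.2 < q.2].
have -> : step_int L = step_int L' + step L p.2 * p.2.
  rewrite /step_int /step big_map big_filter big_distrl/= [in RHS]big_mkcond
    -big_split/=.
  rewrite [LHS]big_seq [RHS]big_seq; apply: eq_bigr => q qL.
  rewrite pmin// mulr1; case: ltP => qp; first by ring.
  by rewrite add0r; congr (_ * _); apply/eqP; rewrite eq_le qp pmin.
apply: addr_ge0; last by rewrite mulr_ge0 ?L0// ltW.
apply: IH.
- rewrite size_map size_filter; apply: leq_trans (_ : size L <= n)%N => //.
  rewrite -(count_predC (fun q : R * R => p.2 < q.2) L) -[X in (X < _)%N]addn0
    ltn_add2l.
  by rewrite -has_count; apply/hasP; exists p => //=; rewrite ltxx.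
- by move=> _ /mapP[q + ->]; rewrite mem_filter /= subr_gt0 => /andP[].
- move=> u u0; rewrite (_ : step L' u = step L (u + p.2)) ?L0 ?addr_gt0//.
  rewrite /step big_map big_filter big_mkcond/= [LHS]big_seq [RHS]big_seq.
  apply: eq_bigr => q qL; case: ltP => qp; first by rewrite lerBrDr.
  by rewrite leNgt (le_lt_trans qp) ?ltrDr// mulr0.
Qed.

Definition step_opp L := [seq (- p.1, p.2) | p <- L].

Lemma step_cat L1 L2 u : step (L1 ++ L2) u = step L1 u + step L2 u.
Proof. by rewrite /step big_cat. Qed.

Lemma step_int_cat L1 L2 : step_int (L1 ++ L2) = step_int L1 + step_int L2.
Proof. by rewrite /step_int big_cat. Qed.

Lemma step_oppE L u : step (step_opp L) u = - step L u.
Proof. by rewrite /step big_map -sumrN; apply: eq_bigr => p _; rewrite mulNr. Qed.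

Lemma step_int_opp L : step_int (step_opp L) = - step_int L.
Proof.
by rewrite /step_int big_map -sumrN; apply: eq_bigr => p _; rewrite mulNr.
Qed.

Lemma step_opp_pos L :
  {in L, forall p, 0 < p.2} -> {in step_opp L, forall p, 0 < p.2}.
Proof. by move=> Lpos _ /mapP[q qL ->] /=; exact: Lpos. Qed.

Lemma cat_pos L1 L2 : {in L1, forall p, 0 < p.2} -> {in L2, forall p, 0 < p.2} ->
  {in L1 ++ L2, forall p, 0 < p.2}.
Proof. by move=> h1 h2 p; rewrite mem_cat => /orP[/h1|/h2]. Qed.

Lemma le_step_int L1 L2 :
  {in L1, forall p, 0 < p.2} -> {in L2, forall p, 0 < p.2} ->
  (forall u, 0 < u -> step L1 u <= step L2 u) -> step_int L1 <= step_int L2.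
Proof.
move=> p1 p2 L12; rewrite -subr_ge0 -step_int_opp -step_int_cat.
apply: step_int_ge0 => [|u u0].
  by apply: cat_pos => //; exact: step_opp_pos.
by rewrite step_cat step_oppE subr_ge0 L12.
Qed.

(** Makes the integral independent of the list representing the step function. *)
Lemma eq_step_int L1 L2 :
  {in L1, forall p, 0 < p.2} -> {in L2, forall p, 0 < p.2} ->
  (forall u, 0 < u -> step L1 u = step L2 u) -> step_int L1 = step_int L2.
Proof.
by move=> p1 p2 L12; apply/eqP; rewrite eq_le !le_step_int// => u u0; rewrite L12.
Qed.

End StepFunctions.

(** * The exponent attached to a completely alternating function *)

Section SpectralExponent.
Context (R : realType) (T : choiceType) (theta : {fset T} -> R).
Hypothesis ca : completely_alternating theta.
Hypothesis theta0 : theta fset0 = 0.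
Implicit Types (S : {fset T * R}) (A : {fset T}) (u y c : R).

Definition upper u S : {fset T} := (fst @` [fset p in S | u <= p.2])%fset.

Lemma upperP u S t :
  reflect (exists2 y, (t, y) \in S & u <= y) (t \in upper u S).
Proof.
rewrite /upper; apply: (iffP (imfsetP _ _ _ _)) => [[[t' y]] /=|[y tS uy]].
  by rewrite !inE /= => /andP[tS uy] ->; exists y.
by exists (t, y) => //=; rewrite !inE tS.
Qed.

Lemma upperU1 u p S :
  upper u (p |` S)%fset = if u <= p.2 then (p.1 |` upper u S)%fset else upper u S.
Proof.
apply/fsetP => t; apply/upperP/idP.
- move=> [y]; rewrite !inE => /orP[/eqP<-/=|tS] uy.
    by rewrite uy !inE eqxx.
  have tu : t \in upper u S by apply/upperP; exists y.
  by case: ifP; rewrite // !inE tu orbT.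
- case: ifP => [up|_].
    rewrite !inE => /orP[/eqP->|/upperP[y tS uy]].
      by exists p.2; rewrite // !inE -surjective_pairing eqxx.
    by exists y; rewrite // !inE tS orbT.
  by move=> /upperP[y tS uy]; exists y; rewrite // !inE tS orbT.
Qed.

Lemma upper0 u : upper u fset0 = fset0.
Proof. by apply/fsetP => t; apply/upperP; rewrite inE; case=> y; rewrite inE. Qed.

(** A pair below level [u] leaves [upper u] unchanged, which kills the difference; any other pair
    acts by adjoining its point. *)
Lemma nabla_upper u (s : seq (T * R)) S :
  nabla (fun S => theta (upper u S)) s S =
  if all (fun p => u <= p.2) s then nabla theta (map fst s) (upper u S) else 0.
Proof.
elim: s S => //= p s IH S; rewrite !IH upperU1.
by case: (u <= p.2) => /=; [case: ifP; rewrite ?subrr|rewrite subrr].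
Qed.

(** Induction removing a pair of lowest level: up to that level [upper] is constant, and above it
    the pair is invisible. *)
Lemma step_upper_exists S : exists L : seq (R * R), {in L, forall p, 0 < p.2} /\
  forall u, 0 < u -> theta (upper u S) = step L u.
Proof.
have [n] := ubnP #|` S|; elim: n S => // n IH S sS.
have [->|Sn0] := eqVneq S fset0.
  by exists [::]; split=> // u u0; rewrite upper0 theta0 /step big_nil.
have [p pS pmin] : exists2 p, p \in S & forall q, q \in S -> p.2 <= q.2.
  have /seq_min : enum_fset S != [::] by rewrite -size_eq0 -cardfs_eq0 in Sn0 *.
  by apply.
pose S' := (S `\ p)%fset.
have SE : S = (p |` S')%fset by rewrite fsetD1K.
have [|L [Lpos LE]] := IH S'.
  by move: sS; rewrite (cardfsD1 p) pS.
(* A pair of nonpositive level is never seen by a positive [u]. *)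
have [p0|p0] := leP p.2 0.
  exists L; split => // u u0.
  by rewrite SE upperU1 leNgt (le_lt_trans p0 u0) /= LE.
(* The new coefficient is what the removed pair contributes for all [u] up to its level. *)
exists ((theta (upper p.2 S) - theta (upper p.2 S'), p.2) :: L); split.
  by move=> q; rewrite inE => /orP[/eqP->|/Lpos].
move=> u u0; rewrite /step big_cons/= -/(step L u) -LE//.
have [up|pu] := leP u p.2; last by rewrite mulr0 add0r SE upperU1 leNgt pu.
have upE S1 : (S1 `<=` S)%fset -> upper u S1 = upper p.2 S1.
  move=> /fsubsetP S1S; apply/fsetP => t; apply/upperP/upperP => -[y tS _];
    exists y => //.
    by have := pmin _ (S1S _ tS).
  by apply: le_trans up _; have := pmin _ (S1S _ tS).
by rewrite mulr1 !upE ?fsubD1set ?fsubsetDl//; lra.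
Qed.

(* The layer-cake integral of [u |-> theta (upper u S)] over [u > 0]. *)
Definition exponent S : R := step_int (proj1_sig (cid (step_upper_exists S))).

Lemma exponentE S L : {in L, forall p, 0 < p.2} ->
  (forall u, 0 < u -> theta (upper u S) = step L u) -> exponent S = step_int L.
Proof.
rewrite /exponent; case: cid => M [Mpos ME] /= Lpos LE.
by apply: eq_step_int => // u u0; rewrite -ME// LE.
Qed.

(** Differences commute with the integral over [u], and by [nabla_upper] the integrand is
    nonpositive for each [u]. *)
Lemma exponent_ca : completely_alternating exponent.
Proof.
move=> p s S.
have [L [Lpos [LE ->]]] : exists L : seq (R * R), {in L, forall p, 0 < p.2} /\
    ((forall u, 0 < u -> nabla (fun S => theta (upper u S)) (p :: s) S =
        step L u) /\
     nabla exponent (p :: s) S = step_int L).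
  elim: (p :: s) S => {p s} [|p s IH] S.
    by have [L [Lpos LE]] := step_upper_exists S; exists L; do !split => //;
      exact: exponentE.
  have [L [Lpos [LE iL]]] := IH S; have [M [Mpos [ME iM]]] := IH (p |` S)%fset.
  exists (L ++ step_opp M); split; first by apply: cat_pos => //;
    exact: step_opp_pos.
  split=> [u u0|]; last by rewrite /= iL iM step_int_cat step_int_opp.
  by rewrite /= LE// ME// step_cat step_oppE.
rewrite (_ : 0 = step_int ([::] : seq (R * R))); last by rewrite /step_int big_nil.
apply: le_step_int => // u u0; rewrite -LE// nabla_upper /step big_nil.
by case: ifP => //= _; exact: (@ca p.1).
Qed.

Lemma exponent_level S A y : 0 < y ->
  (forall u, 0 < u -> upper u S = if u <= y then A else fset0) ->
  exponent S = theta A * y.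
Proof.
move=> y0 SA; rewrite (@exponentE _ [:: (theta A, y)]).
- by rewrite /step_int big_seq1.
- by move=> p; rewrite inE => /eqP->.
- by move=> u u0; rewrite /step big_seq1 SA//=; case: ifP; rewrite ?mulr1// mulr0.
Qed.

Lemma exponent0 : exponent fset0 = 0.
Proof.
rewrite (@exponentE _ [::]) /step_int ?big_nil//.
by move=> u u0; rewrite upper0 /step big_nil.
Qed.

(** Homogeneity under this scaling of levels is what later yields max-stability. *)
Definition scale c S : {fset T * R} := ((fun p => (p.1, c * p.2)) @` S)%fset.

Lemma exponent_scale c S : 0 < c -> exponent (scale c S) = c * exponent S.
Proof.
move=> c0; have [L [Lpos LE]] := step_upper_exists S.
rewrite (@exponentE S L)// (@exponentE _ [seq (p.1, c * p.2) | p <- L]).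
- by rewrite /step_int big_map big_distrr/=; apply: eq_bigr => p _; ring.
- by move=> _ /mapP[p pL ->]; rewrite mulr_gt0// Lpos.
move=> u u0; rewrite (_ : upper u _ = upper (u / c) S).
  rewrite LE ?divr_gt0// /step big_map; apply: eq_bigr => p _.
  by rewrite /= ler_pdivrMr// [c * _]mulrC.
apply/fsetP => t; apply/upperP/upperP => -[y].
  by move=> /imfsetP[[t' y'] /= tS [-> ->]] uy; exists y' => //;
    rewrite ler_pdivrMr// [_ * c]mulrC.
move=> tS; rewrite ler_pdivrMr// [_ * c]mulrC => uy; exists (c * y) => //.
by apply/imfsetP; exists (t, y).
Qed.

End SpectralExponent.

(** * Necessity: properties of extremal coefficient functions *)

Section ExtremalCoefficients.
Context (R : realType) (T : choiceType) d (Omega : measurableType d).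
Variable P : probability Omega R.

Lemma fine_probabilityD (A B : set Omega) : measurable A -> measurable B ->
  fine (P A) - fine (P (A `&` B)) = fine (P (A `\` B)).
Proof.
by move=> mA mB; rewrite measureD ?ltey_eq ?fin_num_measure// fineB
  ?fin_num_measure//; exact: measurableI.
Qed.

Lemma bigcap_fset_measurable (I : choiceType) (E : I -> set Omega) (N : {fset I}) :
  (forall i, measurable (E i)) -> measurable (\bigcap_(i in [set` N]) E i).
Proof. by move=> mE; apply: fin_bigcap_measurable => //; exact: finite_fset. Qed.

Lemma bigcap_fsetU1 (I : choiceType) (E : I -> set Omega) (a : I) (N : {fset I}) :
  \bigcap_(i in [set` (a |` N)%fset]) E i = E a `&` \bigcap_(i in [set` N]) E i.
Proof.
apply/seteqP; split => [w Ew|w [Ea EN] i /=].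
  by split=> [|i iN]; apply: Ew; rewrite /= !inE ?eqxx// iN orbT.
by rewrite !inE => /orP[/eqP->//|]; exact: EN.
Qed.

(** Inclusion-exclusion: the difference along [s] at [K] is the probability that all events of [K]
    and none of [s] occur. *)
Lemma probability_bigcap_cm (I : choiceType) (E : I -> set Omega) :
  (forall i, measurable (E i)) ->
  completely_monotone (fun N => fine (P (\bigcap_(i in [set` N]) E i))).
Proof.
move=> mE s K.
have -> : nabla (fun N => fine (P (\bigcap_(i in [set` N]) E i))) s K =
    nabla (fun N => fine (P (setT `&` \bigcap_(i in [set` N]) E i))) s K.
  by apply: eq_nabla => N; rewrite setTI.
(* The set [G] accumulates the complements of the events already treated. *)
elim: s setT (@measurableT _ Omega) K => [|a s IH] G mG K.
  exact: fine_ge0.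
rewrite nabla_cons (@eq_nabla _ _ _ (fun N => fine (P ((G `\` E a) `&`
  \bigcap_(i in [set` N]) E i)))).
  by apply: IH; exact: measurableD.
move=> N; rewrite bigcap_fsetU1; set C := \bigcap_(i in [set` N]) E i.
have mC : measurable C by exact: bigcap_fset_measurable.
rewrite setIA setIAC fine_probabilityD//; last exact: measurableI.
by congr (fine (P _)); apply/seteqP; split => w [[]]; do !split.
Qed.

(** Union bound on the complements, adding one event at a time. *)
Lemma probability_bigcap_ge (I : choiceType) (E : I -> set Omega) (e : R) :
  (forall i, measurable (E i)) -> (forall i, 1 - e <= fine (P (E i))) ->
  forall N : {fset I}, 1 - #|` N|%:R * e <= fine (P (\bigcap_(i in [set` N]) E i)).
Proof.
move=> mE Ee; elim/finSet_rect => N0 IH0; have [->|[a aN0]] := fset_0Vmem N0.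
  by rewrite cardfs0 mul0r subr0 set_fset0 bigcap_set0 probability_setT.
have := IH0 _ (fproperD1 aN0); rewrite -(fsetD1K aN0) fsetU1K ?fsetD11//.
move: (N0 `\ a)%fset (fsetD11 a N0) => N aN IH {IH0 aN0}.
rewrite bigcap_fsetU1 cardfsU1 aN /= natrD mulrDl mul1r.
set C := \bigcap_(i in _) _ in IH *.
have mC : measurable C by exact: bigcap_fset_measurable.
have : fine (P (C `\` E a)) <= fine (P (~` E a)).
  apply: fine_le; rewrite ?fin_num_measure//;
    do ?[exact: measurableD|exact: measurableC].
  by apply: le_measure; rewrite ?inE;
    do ?[exact: measurableD|exact: measurableC|move=> w []].
rewrite -fine_probabilityD// -setTD -fine_probabilityD// probability_setT setTI
  /= setIC.
have := Ee a; lra.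
Qed.

Lemma bigmaxe_leE (X : T -> Omega -> R) (A : {fset T}) (x : R) :
  [set w | (\big[maxe/-oo]_(t <- A) (X t w)%:E <= x%:E)%E] =
  \bigcap_(t in [set` A]) [set w | X t w <= x].
Proof.
apply/seteqP; split => w /=.
  rewrite /bigcap /= => + t tA; rewrite (big_rem t)//= ge_max lee_fin.
  by case/andP.
move=> Xx; rewrite big_seq_cond; apply: bigmax_le => [|t];
  rewrite ?leNye// andbT => tA.
by rewrite lee_fin; exact: Xx.
Qed.

Variables (X : T -> {RV P >-> R}) (theta : {fset T} -> R).

Lemma measurable_sublevel (t : T) (x : R) : measurable [set w | X t w <= x].
Proof.
have := @measurable_funPT _ _ _ _ (X t) measurableT _ (measurable_itv `]-oo, x]).
by rewrite setTI; congr measurable; apply/seteqP; split=> w /=; rewrite in_itv.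
Qed.

Hypothesis X_stable : simple_max_stable X.
Hypothesis X_ECF : is_ECF X theta.
Hypothesis theta_ge0 : forall A, 0 <= theta A.

Let p (x : R) (A : {fset T}) :=
  fine (P (\bigcap_(t in [set` A]) [set w | X t w <= x])).

Lemma frechet_sublevel (t : T) (x : R) : 0 < x ->
  fine (P [set w | X t w <= x]) = expR (- (1 / x)).
Proof.
move=> x0; have := X_stable.1 t x x0; rewrite /cdf /distribution /pushforward /=.
rewrite (_ : _ @^-1` _ = [set w | X t w <= x]) => [->//|].
by apply/seteqP; split=> w /=; rewrite in_itv.
Qed.

Lemma frechet_ge (t : T) (x : R) : 0 < x ->
  1 - 1 / x <= fine (P [set w | X t w <= x]).
Proof. by move=> x0; rewrite frechet_sublevel// expR_ge1Dx. Qed.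

(** Inverting [ln] requires a positive probability, which the union bound supplies once [x] exceeds
    the size of [A]. *)
Lemma ECF_exp (A : {fset T}) (x : R) : #|` A|%:R < x ->
  p x A = expR (- (theta A / x)).
Proof.
move=> Ax; have x0 : 0 < x by apply: le_lt_trans Ax; rewrite ler0n.
have p0 : 0 < p x A.
  apply: lt_le_trans (probability_bigcap_ge (fun t => measurable_sublevel t x)
    (fun t => frechet_ge t x0) A).
  by rewrite subr_gt0 mul1r ltr_pdivrMr ?mul1r.
have [->|A0] := eqVneq A fset0.
  by rewrite X_ECF.1 mul0r oppr0 expR0 /p set_fset0 bigcap_set0 probability_setT.
rewrite (X_ECF.2 A x A0 x0) bigmaxe_leE -/(p x A).
rewrite (_ : - (- x * ln (p x A) / x) = ln (p x A)) ?lnK//.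
by field; rewrite gt_eqF.
Qed.

Lemma ECF_singleton (t : T) : theta [fset t]%fset = 1.
Proof.
rewrite (X_ECF.2 _ 1) ?ltr01//; last by apply/fset0Pn; exists t; rewrite inE.
rewrite bigmaxe_leE set_fset1 bigcap_set1 frechet_sublevel// divr1 expRK.
by rewrite mulrNN mulr1.
Qed.

(** With [h = theta A / n], the bounds [1 - h <= expR (- h)] and [expR (- h) * (1 + h) <= 1] place
    [1 - expR (- h)] between [h - h * h] and [h]. *)
Lemma ECF_cvg (A : {fset T}) : n%:R * (1 - p n%:R A) @[n --> \oo] --> theta A.
Proof.
have th := theta_ge0 A.
apply: (@squeeze_cvgr _ _ _ _ (fun n : nat => theta A - theta A ^+ 2 / n%:R)
  (fun=> theta A)); last 2 first.
- rewrite -[X in _ --> X]subr0; apply: cvgB; first exact: cvg_cst.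
  rewrite -(mulr0 (theta A ^+ 2)); apply: cvgMr.
  by rewrite -(cvg_shiftS (fun n : nat => n%:R^-1 : R)); exact: cvg_harmonic.
- exact: cvg_cst.
near=> n.
have An : #|` A|%:R < n%:R :> R by rewrite ltr_nat; near: n; exact: nbhs_infty_gt.
have n0 : 0 < n%:R :> R by apply: le_lt_trans An; rewrite ler0n.
rewrite ECF_exp//.
have hE : theta A = n%:R * (theta A / n%:R) by rewrite mulrC divfK// gt_eqF.
have h0 : 0 <= theta A / n%:R by rewrite divr_ge0// ltW.
set h := theta A / n%:R in hE h0 *.
have h1 : 1 - h <= expR (- h) by exact: expR_ge1Dx.
have h2 : expR (- h) * (1 + h) <= 1.
  by rewrite expRN ler_pdivrMl ?expR_gt0// mulr1 expR_ge1Dx.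
apply/andP; split; last by rewrite hE ler_pM2l//; lra.
rewrite (_ : theta A ^+ 2 / n%:R = n%:R * (h * h)); last first.
  by rewrite expr2 /h; field; rewrite gt_eqF.
rewrite hE -mulrBr ler_pM2l//; have := expR_gt0 (- h); nra.
Unshelve. all: by end_near. Qed.

(** In the approximants of [ECF_cvg] the constant has zero difference and [p] is completely
    monotone; the resulting sign survives the limit. *)
Lemma ECF_ca : completely_alternating theta.
Proof.
move=> a s K.
have c : nabla (fun L => n%:R * (1 - p n%:R L)) (a :: s) K @[n --> \oo] -->
  nabla theta (a :: s) K.
  by apply: cvg_nabla => L; exact: ECF_cvg.
rewrite -(cvg_lim _ c)//; apply: limr_le; first by apply/cvg_ex; eexists; exact: c.
apply: nearW => n; rewrite nablaZ nablaB nabla_cst sub0r mulrN oppr_le0.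
by rewrite mulr_ge0// probability_bigcap_cm// => t; exact: measurable_sublevel.
Qed.

Lemma ECF_le (A : {fset T}) : theta A <= #|` A|%:R.
Proof.
have c := @ECF_cvg A; rewrite -(cvg_lim _ c)//; apply: limr_le.
  by apply/cvg_ex; eexists; exact: c.
near=> n; have n0 : 0 < n%:R :> R by rewrite ltr0n; near: n; exact: nbhs_infty_gt.
have := probability_bigcap_ge (fun t => measurable_sublevel t n%:R)
    (fun t => frechet_ge t n0) A; rewrite -/(p _ _) => pA.
have nK : #|` A|%:R = n%:R * (#|` A|%:R * (1 / n%:R)) :> R by field; rewrite gt_eqF.
by rewrite [leRHS]nK ler_pM2l//; lra.
Unshelve. all: by end_near. Qed.

End ExtremalCoefficients.

(** * Laws determined by lower orthants *)

Section OrthantLaws.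
Context (R : realType).

Definition orthants m : set (set (m.-tuple (measurableTypeR R))) :=
  [set B | exists x : 'I_m -> R, B = [set z | forall j, tnth z j <= x j]].

Lemma setI_orthants m : setI_closed (@orthants m).
Proof.
move=> _ _ [x ->] [y ->]; exists (fun j => Num.min (x j) (y j)).
apply/seteqP; split => [z [zx zy] j|z zxy].
  by rewrite le_min zx zy.
by split=> j; have := zxy j; rewrite le_min => /andP[].
Qed.

Lemma sigma_orthants m (B : set (m.-tuple (measurableTypeR R))) :
  measurable B -> <<s @orthants m >> B.
Proof.
move=> mB; pose G := g_sigma_algebraType (@orthants m).
suff : measurable_fun [set: G] (id : G -> m.-tuple (measurableTypeR R)).
  by move=> /(_ measurableT B mB); rewrite setTI.
apply/measurable_fun_tnthP => i.
apply: (measurability _ (RGenOInfty.measurableE R)) => _ [_ [x ->] <-];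
  rewrite setTI.
(* A half-space bounding coordinate [i] by [x] is the union over [k] of orthants bounding every
   other coordinate by [k]. *)
rewrite (_ : _ @^-1` _ = ~` \bigcup_k [set z | forall j, tnth z j <= if j == i
  then x else k%:R]).
  apply: measurableC; apply: bigcupT_measurable => k.
  by apply: sub_sigma_algebra; exists (fun j => if j == i then x else k%:R).
apply/seteqP; split => z /=; rewrite in_itv /= andbT.
  by move=> xz [k _ /(_ i)]; rewrite eqxx leNgt xz.
move=> nz; rewrite ltNge; apply/negP => zx; apply: nz.
have [k kP] : exists k : nat, forall j, tnth z j <= k%:R.
  exists (\max_j Num.truncn `|tnth z j|).+1 => j.
  apply: le_trans (ler_norm _) _; apply: ltW; apply: lt_le_trans (truncnS_gt _) _.
  by rewrite ler_nat ltnS leq_bigmax.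
by exists k => // j; case: eqP => [->|_].
Qed.

Lemma measurable_orthants m : @orthants m `<=` measurable.
Proof.
move=> _ [x ->]; rewrite (_ : mkset _ =
    \bigcap_(j in [set: 'I_m]) ((@tnth m (measurableTypeR R))^~ j @^-1` `]-oo,
      x j])).
  apply: fin_bigcap_measurable => // j _.
  by rewrite -[X in measurable X]setTI; apply: measurable_tnth => //;
    exact: measurable_itv.
by apply/seteqP; split=> z zx j; have := zx j; rewrite /= in_itv//=; exact.
Qed.

(** Orthants are closed under intersection, generate the sigma-algebra and cover the space, so
    measures agreeing on them coincide. *)
Lemma same_law_orthants (T : choiceType)
    d (Omega : measurableType d) (P : probability Omega R) (Y : T -> Omega -> R)
    d' (Omega' : measurableType d') (P' : probability Omega' R)
    (Y' : T -> Omega' -> R) :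
  (forall t, measurable_fun setT (Y t)) -> (forall t, measurable_fun setT (Y' t)) ->
  (forall m (t : 'I_m -> T) (x : 'I_m -> R),
    P [set w | forall j, Y (t j) w <= x j] =
    P' [set w | forall j, Y' (t j) w <= x j]) ->
  same_law P Y P' Y'.
Proof.
move=> mY mY' YY' m t B mB.
have mYt : measurable_fun setT (fun w => [tuple Y (t i) w | i < m] : m.-tuple
  (measurableTypeR R)).
  apply/measurable_fun_tnthP => i; rewrite (_ : _ \o _ = Y (t i)); first exact: mY.
  by apply/funext => w; rewrite /= tnth_mktuple.
have mYt' : measurable_fun setT (fun w => [tuple Y' (t i) w | i < m] : m.-tuple
  (measurableTypeR R)).
  apply/measurable_fun_tnthP => i; rewrite (_ : _ \o _ = Y' (t i));
    first exact: mY'.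
  by apply/funext => w; rewrite /= tnth_mktuple.
pose Z : {mfun Omega >-> m.-tuple (measurableTypeR R)} :=
  HB.pack (fun w => [tuple Y (t i) w | i < m]) (isMeasurableFun.Build _ _ _ _ _
    mYt).
pose Z' : {mfun Omega' >-> m.-tuple (measurableTypeR R)} :=
  HB.pack (fun w => [tuple Y' (t i) w | i < m]) (isMeasurableFun.Build _ _ _ _
    _ mYt').
have mO := @measurable_orthants m.
apply: (@g_sigma_algebra_measure_unique _ _ _ (@orthants m) _
  (fun k => [set z | forall j, tnth z j <= k%:R]) _ _ (distribution P Z)
    (distribution P' Z')).
- exact: mO.
- by move=> k; exists (fun=> k%:R).
- apply/seteqP; split => // z _.
  exists (\max_j Num.truncn `|tnth z j|).+1 => // j.
  apply: le_trans (ler_norm _) _; apply: ltW; apply: lt_le_trans (truncnS_gt _) _.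
  by rewrite ler_nat ltnS leq_bigmax.
- exact: setI_orthants.
- move=> _ [x ->]; rewrite /distribution /pushforward /=.
  transitivity (P [set w | forall j, Y (t j) w <= x j]).
    by congr (P _); apply/seteqP; split => w /= wx j; have := wx j;
      rewrite tnth_mktuple.
  rewrite YY'; congr (P' _); apply/seteqP; split => w /= wx j; have := wx j;
    by rewrite tnth_mktuple.
- move=> k; rewrite (le_lt_trans _ (ltry 1))//; apply: probability_le1; apply: mO.
  by exists (fun=> k%:R).
- exact: sigma_orthants.
Qed.

End OrthantLaws.

(* The right-hand side of [measureD] coerces [P] to a content, which blocks
   rewriting with facts about [P]. *)
Lemma probability_setD (R : realType) d (Omega : measurableType d)
    (P : probability Omega R) (A B : set Omega) : measurable A -> measurable B ->
  P (A `\` B) = (P A - P (A `&` B))%E.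
Proof. by move=> mA mB; rewrite measureD// ltey_eq fin_num_measure. Qed.

Lemma eq_measure_setD0 (R : realType) d (Omega : measurableType d)
    (P : probability Omega R) (A B : set Omega) : measurable A -> measurable B ->
  P (A `\` B) = 0%E -> P (B `\` A) = 0%E -> P A = P B.
Proof.
move=> mA mB AB BA; rewrite (measureDI P mA mB) (measureDI P mB mA).
by rewrite [X in (X + _ = _)%E]AB [X in (_ = X + _)%E]BA setIC.
Qed.

(** * A process built from the level events *)

Section Construction.
Context (R : realType) (T : choiceType) (theta : {fset T} -> R).
Hypothesis theta0 : theta fset0 = 0.
Hypothesis theta1 : forall t, theta [fset t]%fset = 1.
Context d (Omega : measurableType d) (P : probability Omega R).
Variable E : T * R -> set Omega.
Hypothesis mE : forall i, measurable (E i).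
Hypothesis PE : forall N : {fset T * R},
  P (\bigcap_(i in [set` N]) E i) = (expR (- exponent theta0 N))%:E.

Lemma upper_singleton (t : T) (y u : R) :
  upper u [fset (t, y)]%fset = if u <= y then [fset t]%fset else fset0.
Proof. by rewrite -[[fset (t, y)]%fset]fsetU0 upperU1 upper0 fsetU0. Qed.

Lemma probability_level (t : T) (y : R) : 0 < y -> P (E (t, y)) = (expR (- y))%:E.
Proof.
move=> y0; have := PE [fset (t, y)]%fset; rewrite set_fset1 bigcap_set1 => ->.
rewrite (exponent_level theta0 y0 (A := [fset t]%fset)) ?theta1 ?mul1r// => u u0.
exact: upper_singleton.
Qed.

(** The lower pair adds nothing to [upper], so the two events together are as likely as the one of
    higher level. *)
Lemma probability_level_antitone (t : T) (y y' : R) : 0 < y -> y <= y' ->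
  P (E (t, y') `\` E (t, y)) = 0%E.
Proof.
move=> y0 yy'; have y'0 : 0 < y' by exact: lt_le_trans yy'.
rewrite probability_setD//.
rewrite [X in (_ - X)%E](_ : _ = (expR (- y'))%:E).
  by rewrite probability_level// subee.
have := PE [fset (t, y'); (t, y)]%fset.
rewrite bigcap_fsetU1 set_fset1 bigcap_set1 => ->.
rewrite (exponent_level theta0 y'0 (A := [fset t]%fset)) ?theta1 ?mul1r// => u u0.
rewrite upperU1 upper_singleton /=; case: (leP u y) => [uy|_].
  by rewrite (le_trans uy yy') fsetUid.
by rewrite fsetU0.
Qed.

(** Enumerates the positive rationals, with 1 as filler. Countably many levels keep the infimum
    measurable and the union of exceptional sets null. *)
Let r (n : nat) : R :=
  let q := odflt 1 (choice.unpickle n : option rat) in if 0 < q then ratr q else 1.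

Let r_gt0 n : 0 < r n.
Proof. by rewrite /r; case: ifP => // q0; rewrite ltr0q. Qed.

Let r_dense (a b : R) : 0 <= a -> a < b -> exists n, a < r n < b.
Proof.
move=> a0 ab; have [q] := rat_in_itvoo ab; rewrite in_itv/= => /andP[aq qb].
exists (choice.pickle q); rewrite /r choice.pickleK /=.
by rewrite -(ltr0q R) (le_lt_trans a0 aq) aq qb.
Qed.

Let v (t : T) (n : nat) (w : Omega) : \bar R :=
  if w \in E (t, r n) then ((r n)^-1)%:E else +oo%E.

Let V (t : T) (w : Omega) : \bar R := einfs (v t ^~ w) 0.

Let V_le (t : T) (n : nat) (w : Omega) : E (t, r n) w -> (V t w <= ((r n)^-1)%:E)%E.
Proof.
move=> Ew; apply: ereal_inf_lbound; exists n => //.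
by rewrite /v mem_set.
Qed.

Let V_lt (t : T) (w : Omega) (z : R) : (V t w < z%:E)%E ->
  exists2 n, E (t, r n) w & (r n)^-1 < z.
Proof.
move=> /ereal_inf_lt[_ [n _ <-]]; rewrite /v.
case: ifP => [/set_mem Ew|_]; last by rewrite ltNge leey.
by rewrite lte_fin; exists n.
Qed.

Let V_ge0 (t : T) (w : Omega) : (0 <= V t w)%E.
Proof.
apply: le_ereal_inf_tmp => _ [n _ <-]; rewrite /v; case: ifP => // _.
by rewrite lee_fin invr_ge0 ltW.
Qed.

Let mV t : measurable_fun setT (V t).
Proof.
apply: measurable_fun_einfs => n; apply: measurable_fun_ifT => //.
apply: (measurable_fun_bool true); rewrite setTI.
rewrite (_ : _ @^-1` _ = E (t, r n))//.
by apply/seteqP; split => w /=; [move/set_mem|move/mem_set].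
Qed.

(** [fine] turns [+oo] into 0; by [V_infinite] this affects a null set only. *)
Definition extremal_process (t : T) (w : Omega) : R := fine (V t w).

Lemma measurable_process t : measurable_fun setT (extremal_process t).
Proof. by apply: measurableT_comp => //; exact: fine_measurable. Qed.

Lemma measurable_process_le (t : T) (x : R) :
  measurable [set w | extremal_process t w <= x].
Proof.
have := measurable_process t measurableT (measurable_itv `]-oo, x]).
by rewrite setTI; congr measurable; apply/seteqP; split=> w /=; rewrite in_itv.
Qed.

Let V_ley (t : T) (x : R) (w : Omega) : 0 < x -> (V t w <= x%:E)%E ->
  extremal_process t w <= x.
Proof.
move=> x0; rewrite /extremal_process; have := V_ge0 t w.
by case: (V t w) => [a| |] //= _; rewrite ?lee_fin//.
Qed.

(** Outside a null set the event at level [x^-1] entails those at all lower rational levels, and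
    such levels approach [x^-1]. *)
Lemma level_subset_process (t : T) (x : R) : 0 < x ->
  P (E (t, x^-1) `\` [set w | extremal_process t w <= x]) = 0%E.
Proof.
move=> x0; apply/negligibleP.
  by apply: measurableD => //; exact: measurable_process_le.
pose D n := if r n <= x^-1 then E (t, x^-1) `\` E (t, r n) else set0.
apply: (@negligibleS _ _ _ _ (\bigcup_n D n)); last first.
  apply: negligible_bigcup => n; rewrite /D; case: ifP => rx;
    last exact: negligible_set0.
  by apply/negligibleP; [exact: measurableD|exact: probability_level_antitone].
move=> w [Ew]; apply: contra_notP => nD; apply: V_ley => //.
apply/lee_addgt0Pr => e e0; rewrite -EFinD.
have xe0 : 0 < x + e by rewrite addr_gt0.
have xe1 : 0 <= (x + e)^-1 by rewrite invr_ge0 ltW.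
have xe2 : (x + e)^-1 < x^-1 by rewrite ltf_pV2 ?posrE// ltrDl.
have [n /andP[rn1 rn2]] := r_dense xe1 xe2.
apply: (@le_trans _ _ ((r n)^-1)%:E).
  apply: V_le; apply: contra_notP nD => nE; exists n => //.
  by rewrite /D (ltW rn2).
by rewrite lee_fin -[leRHS]invrK lef_pV2 ?posrE ?invr_gt0// ltW.
Qed.

Lemma probability_eq0 (A : set Omega) :
  (forall e : R, 0 < e -> (P A <= e%:E)%E) -> P A = 0%E.
Proof.
move=> Ae; apply/eqP; rewrite -measure_le0; apply/lee_addgt0Pr => e e0.
by rewrite add0e Ae.
Qed.

Let mV_infinite t : measurable [set w | V t w = +oo%E].
Proof. by have := mV t measurableT (emeasurable_set1 +oo%E); rewrite setTI. Qed.

(** An infinite value means that every rational level fails, while level [r n] fails with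
    probability at most [r n], which can be made arbitrarily small. *)
Let V_infinite t : P [set w | V t w = +oo%E] = 0%E.
Proof.
apply: probability_eq0 => e e0; have [n /andP[_ re]] := r_dense (lexx 0) e0.
apply: (@le_trans _ _ (P (~` E (t, r n)))).
  apply: le_measure; rewrite ?inE//; first exact: measurableC.
  by move=> w /= Vw Ew; have := V_le Ew; rewrite Vw.
rewrite probability_setC// probability_level// -EFinB lee_fin.
by have := expR_ge1Dx (- r n); lra.
Qed.

Lemma process_subset_level (t : T) (x : R) : 0 < x ->
  P ([set w | extremal_process t w <= x] `\` E (t, x^-1)) = 0%E.
Proof.
move=> x0; have y0 : 0 < x^-1 by rewrite invr_gt0.
have mF := measurable_process_le t x.
apply: probability_eq0 => e e0.
(* A level slightly below [x^-1]: the first term keeps it positive, and the second makes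
   [expR (- q) - expR (- x^-1)] at most [e]. *)
pose q := Num.max (x^-1 / 2) (x^-1 - e).
have q0 : 0 < q by rewrite lt_max divr_gt0.
have qy : q < x^-1 by rewrite gt_max; apply/andP; split; lra.
pose D n := if q <= r n then E (t, r n) `\` E (t, q) else set0.
have mD n : measurable (D n) by rewrite /D; case: ifP => // _; exact: measurableD.
have mUD : measurable (\bigcup_n D n) by exact: bigcupT_measurable.
have PD : P (\bigcup_n D n) = 0%E.
  apply/negligibleP => //; apply: negligible_bigcup => n; apply/negligibleP => //.
  by rewrite /D; case: ifP => rx;
    [exact: probability_level_antitone|exact: measure0].
pose N := [set w | V t w = +oo%E] `|` \bigcup_n D n.
have mN : measurable N by exact: measurableU.
have PN : P N = 0%E.
  apply/negligibleP => //; apply: negligibleU; apply/negligibleP => //.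
  exact: V_infinite.
apply: (@le_trans _ _ (P (N `|` (E (t, q) `\` E (t, x^-1))))).
  apply: le_measure; rewrite ?inE; first exact: measurableD.
    by apply: measurableU => //; exact: measurableD.
  move=> w [/= Fw nEw].
  have [Vy|Vfin] := eqVneq (V t w) +oo%E; first by left; left.
  have [Eq|nEq] := pselect (E (t, q) w); first by right.
  left; right.
  have : (V t w < (q^-1)%:E)%E.
    have Vf : V t w \is a fin_num by rewrite fin_numElt (lt_le_trans (ltNyr 0))
      ?V_ge0//= ltey.
    rewrite -(fineK Vf) lte_fin; apply: le_lt_trans Fw _.
    by rewrite -[ltLHS]invrK ltf_pV2 ?posrE.
  move=> /V_lt[n En rq]; exists n => //; rewrite /D ifT//.
  by rewrite ltW// -ltf_pV2 ?posrE.
have PB : P (E (t, q) `\` E (t, x^-1)) = (expR (- q) - expR (- x^-1))%:E.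
  rewrite probability_setD// EFinB -(probability_level t q0)
    -(probability_level t y0).
  congr (_ - _)%E; apply: eq_measure_setD0 => //; first exact: measurableI.
    by rewrite (_ : _ `\` _ = set0) ?measure0//; apply/seteqP; split => // w [[]].
  rewrite (_ : _ `\` _ = E (t, x^-1) `\` E (t, q)) ?probability_level_antitone
    1?ltW//.
  by rewrite setDIr setDv setU0.
apply: le_trans (measureU2 _ mN _) _; first exact: measurableD.
apply: (@le_trans _ _ (0 + (expR (- q) - expR (- x^-1))%:E)%E).
  by apply: leeD; rewrite le_eqVlt; apply/orP; left; apply/eqP;
    [exact: PN|exact: PB].
rewrite add0e lee_fin.
have eq1 : expR (- x^-1) = expR (- q) * expR (- (x^-1 - q)).
  by rewrite -expRD; congr expR; ring.
have h1 := expR_ge1Dx (- (x^-1 - q)).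
have h2 : expR (- q) <= 1 by rewrite -expR0 ler_expR oppr_le0 ltW.
have h3 : x^-1 - e <= q by rewrite le_max lexx orbT.
rewrite eq1; have := expR_gt0 (- q); nra.
Qed.

(** Sublevel events and level events differ by null sets, and finitely many null sets have a null
    union. *)
Lemma probability_process_le (N : {fset T * R}) : (forall i, i \in N -> 0 < i.2) ->
  P (\bigcap_(i in [set` N]) [set w | extremal_process i.1 w <= i.2^-1]) =
  (expR (- exponent theta0 N))%:E.
Proof.
move=> Npos; rewrite -PE.
have mF (i : T * R) : measurable [set w | extremal_process i.1 w <= i.2^-1] by
  exact: measurable_process_le.
have key (A B : T * R -> set Omega) : (forall i, measurable (A i)) ->
    (forall i, measurable (B i)) -> (forall i, i \in N -> P (A i `\` B i) = 0%E) ->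
    P (\bigcap_(i in [set` N]) A i `\` \bigcap_(i in [set` N]) B i) = 0%E.
  move=> mA mB AB; apply/negligibleP.
    by apply: measurableD; exact: bigcap_fset_measurable.
  apply: (@negligibleS _ _ _ _ (\big[setU/set0]_(i <- N) (A i `\` B i))).
    move=> w [Aw nBw]; rewrite -bigcup_seq; apply: contra_notP nBw => nU i iN.
    by apply: contra_notP nU => nB; exists i => //; split => //; exact: Aw.
  rewrite big_seq; elim/big_ind: _ => [|A1 A2|i iN].
  - exact: negligible_set0.
  - exact: negligibleU.
  - by apply/negligibleP; [exact: measurableD|exact: AB].
apply: eq_measure_setD0; do ?exact: bigcap_fset_measurable.
- apply: key => // -[t y] /Npos /= y0; have := @process_subset_level t y^-1.
  by rewrite invr_gt0 invrK; exact.
- apply: key => // -[t y] /Npos /= y0; have := @level_subset_process t y^-1.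
  by rewrite invr_gt0 invrK; exact.
Qed.

End Construction.

(** * Max-stability and extremal coefficients of the process *)

Section Realization.
Context (R : realType) (T : choiceType) (theta : {fset T} -> R).
Hypothesis theta0 : theta fset0 = 0.
Hypothesis theta1 : forall t, theta [fset t]%fset = 1.
Context d (Omega : measurableType d) (P : probability Omega R).
Variable E : T * R -> set Omega.
Hypothesis mE : forall i, measurable (E i).
Hypothesis PE : forall N : {fset T * R},
  P (\bigcap_(i in [set` N]) E i) = (expR (- exponent theta0 N))%:E.

Let Z := extremal_process E.
Let mZ (t : T) : measurable_fun setT (Z t) := @measurable_process _ _ _ _ _ mE t.

HB.instance Definition _ (t : T) := isMeasurableFun.Build _ _ _ _ (Z t) (mZ t).

Definition process_RV (t : T) : {RV P >-> R} := Z t.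

(** Bounds turn into levels by inversion. A repeated point yields several pairs, of which the
    highest level decides. *)
Definition point_levels m (t : 'I_m -> T) (x : 'I_m -> R) : {fset T * R} :=
  [fset (t j, (x j)^-1) | j in 'I_m]%fset.

Lemma probability_orthant m (t : 'I_m -> T) (x : 'I_m -> R) :
  P [set w | forall j, Z (t j) w <= x j] =
  if [forall j, 0 < x j] then (expR (- exponent theta0 (point_levels t x)))%:E
    else 0%E.
Proof.
case: ifPn => [/forallP x0|/forallPn[j]].
  rewrite -(probability_process_le theta1 mE PE); last first.
    by move=> i /imfsetP[j _ ->] /=; rewrite invr_gt0.
  congr (P _); apply/seteqP; split => w /=.
    by move=> Zx i /= /imfsetP[j _ ->] /=; rewrite invrK.
  move=> Zx j; have := Zx (t j, (x j)^-1); rewrite /= invrK; apply.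
  by apply/imfsetP; exists j.
(* With a nonpositive bound, the orthant lies in [Z (t j) <= e] for every [e > 0], of probability
   [expR (- e^-1) <= e]. *)
rewrite -leNgt => xj; apply: probability_eq0 => e e0.
have mO : measurable [set w | forall j, Z (t j) w <= x j].
  rewrite (_ : mkset _ = \bigcap_(j in [set: 'I_m]) [set w | Z (t j) w <= x j]).
    by apply: fin_bigcap_measurable => // i _; exact: measurable_process_le.
  by apply/seteqP; split=> [w Zx i _|w Zx i]; [exact: Zx|exact: (Zx i I)].
apply: (@le_trans _ _ (P [set w | Z (t j) w <= e])).
  apply: le_measure; rewrite ?inE//; first exact: measurable_process_le.
  by move=> w /(_ j) /= Zx; rewrite (le_trans Zx)// (le_trans xj)// ltW.
have -> : P [set w | Z (t j) w <= e] = (expR (- e^-1))%:E.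
  have e1 : 0 < e^-1 by rewrite invr_gt0.
  rewrite -(probability_level theta1 PE (t j) e1).
  apply: eq_measure_setD0 => //; first exact: measurable_process_le.
  - exact: (process_subset_level theta1 mE PE).
  - exact: (level_subset_process theta1 mE PE).
rewrite lee_fin expRN -[leRHS]invrK lef_pV2 ?posrE ?expR_gt0 ?invr_gt0//.
by have := expR_ge1Dx e^-1; lra.
Qed.

Lemma point_levels_scale m (t : 'I_m -> T) (x : 'I_m -> R) c :
  point_levels t (fun j => x j / c) = scale c (point_levels t x).
Proof.
apply/fsetP => i; apply/imfsetP/imfsetP => /= -[].
  move=> j _ ->; exists (t j, (x j)^-1); first by apply/imfsetP; exists j.
  by rewrite /= invf_div.
by move=> _ /imfsetP[j _ ->] ->; exists j; rewrite //= invf_div.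
Qed.

(** Independence raises the orthant probability to the power [n.+1], which multiplies the exponent
    by [n.+1]; by homogeneity this equals dividing the bounds by [n.+1]. *)
Lemma process_RV_stable : simple_max_stable process_RV.
Proof.
split=> [t x x0|n d' Omega' P' Y [Ylaw Yind]].
  have := @probability_orthant 1 (fun=> t) (fun=> x).
  rewrite ifT; last by apply/forallP.
  rewrite (_ : mkset _ = Z t @^-1` `]-oo, x]); last first.
    apply/seteqP; split=> w /=; rewrite in_itv/=; first exact: (@^~ ord0).
    by move=> ? _.
  rewrite /cdf /distribution /pushforward /= => ->; congr (expR (- _))%:E.
  have -> : @point_levels 1 (fun=> t) (fun=> x) = [fset (t, x^-1)]%fset :>
    {fset T * R}.
    apply/fsetP => i; rewrite inE; apply/imfsetP/eqP => [[j _ ->//]|->].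
    by exists (ord0 : 'I_1).
  rewrite (exponent_level theta0 (y := x^-1) (A := [fset t]%fset)) ?invr_gt0//.
    by rewrite theta1.
  by move=> u u0; exact: upper_singleton.
pose M t w := \big[Num.max/Y ord0 t w]_(i < n.+1) Y i t w.
have mM t : measurable_fun setT (M t).
  rewrite /M; elim: (index_enum _) => [|i s IH].
    by under eq_fun do rewrite big_nil; exact: measurable_funPT.
  by under eq_fun do rewrite big_cons; apply: measurable_maxr.
apply: same_law_orthants => [//|t|m t x].
  by apply: measurable_funM => //; exact: mZ.
have n0 : 0 < n.+1%:R :> R by [].
rewrite (_ : [set w | forall j, n.+1%:R * process_RV (t j) w <= x j] =
    [set w | forall j, Z (t j) w <= x j / n.+1%:R]); last first.
  by apply/seteqP; split=> w /= Zx j; have := Zx j; rewrite ler_pdivlMr// mulrC.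
rewrite probability_orthant point_levels_scale exponent_scale//.
pose F i := [set w | forall j, Y i (t j) w <= x j].
have -> : [set w | forall j, M (t j) w <= x j] = \bigcap_(i in [set` [set:
  'I_n.+1]%SET]) F i.
  apply/seteqP; split => w /=.
    by move=> Mx i _ j; move/bigmax_leP : (Mx j) => [_]; exact.
  by move=> Fx j; apply/bigmax_leP; split=> [|i _]; apply: Fx; rewrite /= inE.
have mS i (j : 'I_m) : process_sigma_algebra (fun t => Y i t) [set w | Y i (t
  j) w <= x j].
  apply: sub_sigma_algebra; exists (t j) => //; exists `]-oo, x j]%classic.
    exact: measurable_itv.
  by rewrite setTI; apply/seteqP; split=> w /=; rewrite in_itv.
(* Independence concerns the sigma-algebras of whole processes; [F i] belongs to one as a finite
   intersection of its generators. *)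
rewrite Yind => [|i _]; last first.
  rewrite (_ : F i = \bigcap_(j in [set: 'I_m]) [set w | Y i (t j) w <= x j]).
    apply: (@fin_bigcap_measurable _ (g_sigma_algebraType
      (\bigcup_t preimage_set_system setT (Y i t) (@measurable _
        (measurableTypeR R))))) => // j _.
    exact: mS.
  by apply/seteqP; split=> [w Fx j _|w Fx j]; [exact: Fx|exact: (Fx j I)].
have PF i : P' (F i) = P [set w | forall j, Z (t j) w <= x j].
  pose O := [set z : m.-tuple (measurableTypeR R) | forall j, tnth z j <= x j].
  have := Ylaw i m t O; rewrite /fdd /pushforward.
  rewrite (_ : _ @^-1` O = F i); last first.
    by apply/seteqP; split=> w /= Ox j; have := Ox j; rewrite tnth_mktuple.
  rewrite (_ : _ @^-1` O = [set w | forall j, Z (t j) w <= x j]); last first.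
    by apply/seteqP; split=> w /= Ox j; have := Ox j; rewrite tnth_mktuple.
  by apply; apply: measurable_orthants; exists x.
under eq_bigr do rewrite PF probability_orthant.
have -> : [forall j, 0 < x j / n.+1%:R] = [forall j, 0 < x j].
  by apply: eq_forallb => j; rewrite pmulr_lgt0// invr_gt0.
rewrite big_const cardsT card_ord; case: ifP => _.
  elim: n.+1 {n0 Y Ylaw Yind M mM F mS PF} => [|k IH].
    by rewrite mul0r oppr0 expR0.
  rewrite iterS IH -EFinM -expRD; congr (expR _)%:E.
  by rewrite -natr1; ring.
(* There is at least one copy, so the product has a zero factor. *)
by rewrite iterS mul0e.
Qed.

Lemma process_RV_ECF : is_ECF process_RV theta.
Proof.
split=> // A x A0 x0; rewrite bigmaxe_leE.
pose N := [fset (t, x^-1) | t in A]%fset.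
have -> : P (\bigcap_(t in [set` A]) [set w | process_RV t w <= x]) =
    (expR (- exponent theta0 N))%:E.
  rewrite -(probability_process_le theta1 mE PE); last first.
    by move=> i /imfsetP[t _ ->] /=; rewrite invr_gt0.
  congr (P _); apply/seteqP; split => w /= Zx.
    by move=> i /= /imfsetP[t tA ->] /=; rewrite invrK; exact: Zx.
  move=> t tA; have := Zx (t, x^-1); rewrite /= invrK; apply.
  by apply/imfsetP; exists t.
rewrite /= expRK (exponent_level theta0 (y := x^-1) (A := A)) ?invr_gt0//.
  by rewrite mulrNN mulrCA divff ?gt_eqF// mulr1.
move=> u u0; apply/fsetP => t; apply/upperP/idP.
  by move=> [y /imfsetP[t1 /= tA [-> ->]]] ->.
case: ifP => // ux tA; exists x^-1 => //.
by apply/imfsetP; exists t.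
Qed.

End Realization.

(** * Characterization of the set and compactness *)

Lemma ThetaP (R : realType) (T : choiceType) (theta : {fset T} -> R) :
  Theta theta <->
  [/\ theta fset0 = 0, forall t, theta [fset t]%fset = 1 &
    completely_alternating theta].
Proof.
split=> [[th [d [W [P [X [Xs Xe]]]]]]|[th0 th1 ca]].
  split; [exact: Xe.1|exact: ECF_singleton Xs Xe|exact: ECF_ca Xs Xe th].
split=> [A|].
  (* First-order alternation makes [theta] monotone, so removing points down to the empty set gives
     nonnegativity. *)
  elim/finSet_rect: A => A IH; have [->|[a aA]] := fset_0Vmem A;
    first by rewrite th0.
  have := ca a [::] (A `\ a)%fset; rewrite /= fsetD1K// subr_le0.
  by apply: le_trans; apply: IH; exact: fproperD1.
have Phi0 : expR (- exponent th0 fset0) = 1 by rewrite exponent0 oppr0 expR0.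
have cm := completely_monotone_expN (exponent_ca ca th0).
have [d [W [P [E [mE PE]]]]] := completely_monotone_probability cm Phi0.
exists d, W, P, (process_RV P mE); split.
- exact: (process_RV_stable th1 mE PE).
- exact: (process_RV_ECF th1 mE PE).
Qed.

Lemma Theta_closed (R : realType) (T : choiceType) : closed (@Theta R T).
Proof.
have cont (A : {fset T}) : continuous (fun theta : {ptws {fset T} -> R} => theta A).
  exact: (@proj_continuous _ (fun=> R) A).
have -> : @Theta R T = [set theta | theta fset0 = 0] `&`
    \bigcap_t [set theta | theta [fset t]%fset = 1] `&`
    \bigcap_(i : T * seq T * {fset T})
      [set theta | nabla theta (i.1.1 :: i.1.2) i.2 <= 0].
  apply/seteqP; split => theta.
    by move=> /ThetaP[th0 th1 ca]; split=> [|i _]; [split=> // t _;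
      exact: th1|exact: ca].
  move=> [[th0 th1] ca]; apply/ThetaP; split => // [t|a s K]; first exact: th1.
  exact: (ca (a, s, K)).
apply: closedI; first apply: closedI.
- exact: (closed_comp (fun _ _ => cont _ _) (@closed_eq R 0)).
- apply: closed_bigI => t _.
  exact: (closed_comp (fun _ _ => cont _ _) (@closed_eq R 1)).
- apply: closed_bigI => -[[a s] K] _.
  (* Continuity of a difference in [theta] is [cvg_nabla] along the neighbourhood filter. *)
  apply: (closed_comp (D := [set y : R | y <= 0]) _ (@closed_le R 0)) => theta _.
  exact: (@cvg_nabla R T {ptws {fset T} -> R} (nbhs theta) _ (fun f => f) theta
    (a :: s) K (fun L => cont L theta)).
Qed.

Theorem corollary14 (R : realType) (T : choiceType) :
  compact (@Theta R T).
Proof.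
have K : compact [set f : {ptws {fset T} -> R} |
    forall A, `[0, #|` A|%:R]%classic (f A)].
  exact: (@tychonoff _ (fun=> R) (fun A : {fset T} => `[0, #|` A|%:R]%classic)
    (fun A => @segment_compact R 0 #|` A|%:R)).
apply: subclosed_compact K _; first exact: Theta_closed.
move=> theta [th [d [W [P [X [Xs Xe]]]]]] A /=.
by rewrite in_itv /= th (ECF_le Xs Xe).
Qed.
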